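(* For $t\in[0,1]$, define $$P_t=\frac14\begin{pmatrix}3+t & 1-t\\ 1+t & 3-t\end{pmatrix}.$$ For $0\le t<1$, the matrices $P_t$ are positive, pairwise similar, and pairwise SSE$-\mathbb{R}_+$. However, for any positive integer $L\ge 2$, there exists $t\in(0,1)$ such that there is no strong shift equivalence over $\mathbb{R}_+$ of lag less than $L$ between $P_0$ and $P_t$ using only matrices with size less than $L$ (i.e. no strong shift equivalence over $\mathbb{R}_+$ from $P_0$ to $P_t$ whose lag is less than $L$ and whose size is less than $L$).
   Context: A matrix is positive if all its entries are $>0$. $\mathbb{R}_+$ is the semiring of nonnegative real numbers. Square matrices $A,B$ over $\mathbb{R}_+$ (possibly of different sizes) are elementary strong shift equivalent over $\mathbb{R}_+$ (ESSE$-\mathbb{R}_+$) if there exist (possibly rectangular) matrices $U,V$ over $\mathbb{R}_+$ with $A=UV$, $B=VU$. They are strong shift equivalent over $\mathbb{R}_+$ (SSE$-\mathbb{R}_+$) if there is a finite sequence of square matrices $A=A_0,A_1,\ldots,A_l=B$ over $\mathbb{R}_+$ with $A_i$ ESSE$-\mathbb{R}_+$ to $A_{i+1}$ for all $0\le i<l$. Such a finite sequence is a strong shift equivalence over $\mathbb{R}_+$; the number $l$ is its lag; its size is $\max\{n_i : 0\le i\le l\}$, where $A_i$ is $n_i\times n_i$. *)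

(* Defs.v *)
From HB Require Import structures.
From mathcomp Require Import all_boot all_order all_algebra.
From mathcomp Require Import reals.

Set Implicit Arguments.
Unset Strict Implicit.
Unset Printing Implicit Defensive.

Import Order.TTheory GRing.Theory Num.Theory.
Local Open Scope ring_scope.

Definition sqmx (R : realType) := {n : nat & 'M[R]_n}.

Definition to_sqmx (R : realType) (n : nat) (A : 'M[R]_n) : sqmx R :=
  Tagged (fun n => 'M[R]_n) A.

Definition sqdim (R : realType) (A : sqmx R) : nat := tag A.

(* Nonempty square matrices over R_+; MathComp also has 0 x 0 matrices. *)
Definition sqnneg (R : realType) (A : sqmx R) : Prop :=
  (0 < sqdim A)%N /\ tagged A \is a mxOver Num.nneg.

Definition esse (R : realType) (A B : sqmx R) : Prop :=
  exists (U : 'M[R]_(sqdim A, sqdim B)) (V : 'M[R]_(sqdim B, sqdim A)),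
    [/\ U \is a mxOver Num.nneg, V \is a mxOver Num.nneg,
        tagged A = U *m V & tagged B = V *m U].

(* A strong shift equivalence of lag l is the finite sequence s 0, ..., s l;
   the values of s beyond l are irrelevant. *)
Definition is_sse (R : realType) (l : nat) (s : nat -> sqmx R)
    (A B : sqmx R) : Prop :=
  [/\ s 0%N = A, s l = B,
      forall i, (i <= l)%N -> sqnneg (s i)
    & forall i, (i < l)%N -> esse (s i) (s i.+1)].

Definition sse_size (R : realType) (l : nat) (s : nat -> sqmx R) : nat :=
  \max_(i < l.+1) sqdim (s i).

Definition sse (R : realType) (A B : sqmx R) : Prop :=
  exists (l : nat) (s : nat -> sqmx R), is_sse l s A B.

Definition Pmx (R : realType) (t : R) : 'M[R]_2 :=
  4^-1 *: \matrix_(i, j)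
    nth 0 (nth [::] [:: [:: 3 + t; 1 - t]; [:: 1 + t; 3 - t]] i) j.

(* Main.v *)
Require Import Defs.
From HB Require Import structures.
From mathcomp Require Import all_boot all_order all_algebra.
From mathcomp Require Import reals.
From mathcomp Require Import ring lra.

Set Implicit Arguments.
Unset Strict Implicit.
Unset Printing Implicit Defensive.

Import Order.TTheory GRing.Theory Num.Theory.
Local Open Scope ring_scope.

(** The vectors (1, 1) and y_t = (-(1 - t), 1 + t) are eigenvectors of P_t for
    the eigenvalues 1 and 1/2.  In the plane with P_t diagonalised, the positive
    cones of P_t and P_u (t <= u) can be placed one inside the other, and as
    long as u - t is small P_t maps the larger cone into the smaller one; the
    inclusion and this map give an elementary equivalence between P_t and P_u.
    Finitely many such steps lead from 0 to any u < 1, since each step doubles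
    (1 + t) / (1 - t).

    Conversely a strong shift equivalence of lag l yields nonnegative 2 x 2
    matrices U, V intertwining P_0 and P_t with V U = P_t ^ l.  Up to reciprocal
    scalars both fix (1, 1), so they preserve lower and upper bounds of vectors.
    As y_t >= -(1 - t) and U y_t is proportional to (-1, 1), all entries of
    U y_t are at most 1 - t in absolute value, hence so are those of
    V U y_t = 2 ^ -l y_t; thus 2 ^ -l (1 + t) <= 1 - t, which bounds l from below
    independently of the size. *)

(** * Two-by-two matrix calculus *)

Definition mx2 (R : realType) (a b c d : R) : 'M[R]_2 :=
  \matrix_(i, j) nth 0 (nth [::] [:: [:: a; b]; [:: c; d]] i) j.

Definition col2 (R : realType) (a b : R) : 'cV[R]_2 :=
  \col_i nth 0 [:: a; b] i.

Lemma mx2_eta (R : realType) (A : 'M[R]_2) :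
  A = mx2 (A 0 0) (A 0 1) (A 1 0) (A 1 1).
Proof.
apply/matrixP=> i j; rewrite mxE.
by case: i => [[|[|]]] //= i; case: j => [[|[|]]] //= j; congr (A _ _); apply: val_inj.
Qed.

Lemma mx2M (R : realType) (a b c d a' b' c' d' : R) :
  mx2 a b c d *m mx2 a' b' c' d' =
  mx2 (a * a' + b * c') (a * b' + b * d') (c * a' + d * c') (c * b' + d * d').
Proof.
apply/matrixP=> i j; rewrite !mxE !big_ord_recl big_ord0 !mxE /= addr0.
by case: i => [[|[|]]] //= i; case: j => [[|[|]]].
Qed.

Lemma mx2_col2 (R : realType) (a b c d x y : R) :
  mx2 a b c d *m col2 x y = col2 (a * x + b * y) (c * x + d * y).
Proof.
apply/matrixP=> i j; rewrite !mxE !big_ord_recl big_ord0 !mxE /= addr0.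
by case: i => [[|[|]]].
Qed.

Lemma scale_col2 (R : realType) (k x y : R) :
  k *: col2 x y = col2 (k * x) (k * y).
Proof. by apply/matrixP=> i j; rewrite !mxE; case: i => [[|[|]]]. Qed.

Lemma col2_inj (R : realType) (x y x' y' : R) :
  col2 x y = col2 x' y' -> x = x' /\ y = y'.
Proof.
by move=> /matrixP e; have := e 0 0; have := e 1 0; rewrite !mxE /=.
Qed.

Lemma mx2_over (R : realType) (S : {pred R}) (a b c d : R) :
  [&& a \in S, b \in S, c \in S & d \in S] -> mx2 a b c d \is a mxOver S.
Proof.
case/and4P=> Sa Sb Sc Sd; apply/mxOverP=> i j; rewrite mxE.
by case: i => [[|[|]]] //= i; case: j => [[|[|]]].
Qed.

Lemma Pmx_mx2 (R : realType) (t : R) :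
  Pmx t = mx2 (4^-1 * (3 + t)) (4^-1 * (1 - t)) (4^-1 * (1 + t)) (4^-1 * (3 - t)).
Proof.
apply/matrixP=> i j; rewrite !mxE.
by case: i => [[|[|]]] //= i; case: j => [[|[|]]].
Qed.

Lemma Pmx_pos (R : realType) (t : R) : 0 <= t < 1 -> Pmx t \is a mxOver Num.pos.
Proof.
move=> /andP[t0 t1]; rewrite Pmx_mx2; apply: mx2_over.
by rewrite !posrE; apply/and4P; split; lra.
Qed.

Lemma sqnneg_Pmx (R : realType) (t : R) : 0 <= t < 1 -> sqnneg (to_sqmx (Pmx t)).
Proof.
move=> /Pmx_pos/mxOverP Pt; split=> //; apply/mxOverP=> i j.
by have := Pt i j; rewrite posrE nnegrE => /ltW.
Qed.

(** * Strong shift equivalence as an equivalence relation *)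

Lemma esse_sym (R : realType) (A B : sqmx R) : esse A B -> esse B A.
Proof. by move=> [U [V [U0 V0 AE BE]]]; exists V, U. Qed.

Lemma sse_refl (R : realType) (A : sqmx R) : sqnneg A -> sse A A.
Proof. by move=> A0; exists 0%N, (fun=> A). Qed.

Lemma sse_sym (R : realType) (A B : sqmx R) : sse A B -> sse B A.
Proof.
move=> [l [s [s0 sl snn se]]]; exists l, (fun i => s (l - i)%N); split.
- by rewrite subn0.
- by rewrite subnn.
- by move=> i _; apply: snn; rewrite leq_subr.
- move=> i il; apply: esse_sym; rewrite -[X in esse _ (s X)]subSS subSn //.
  by apply: se; rewrite ltn_subrL (leq_trans _ il).
Qed.

Lemma sse_trans (R : realType) (B A C : sqmx R) : sse A B -> sse B C -> sse A C.
Proof.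
move=> [l [s [s0 sl snn se]]] [m [r [r0 rm rnn re]]].
exists (l + m)%N, (fun i => if (i <= l)%N then s i else r (i - l)%N); split.
- by rewrite leq0n.
- case: leqP => [|_]; last by rewrite addKn.
  by rewrite -{2}[l]addn0 leq_add2l leqn0 => /eqP m0; rewrite -rm m0 addn0 sl r0.
- move=> i ile; case: leqP => [/snn //|li].
  by apply: rnn; rewrite leq_subLR.
- move=> i ilt; case: (ltngtP i l) => [il|li|il].
  + exact: se.
  + by rewrite subSn ?(ltnW li)//; apply: re; rewrite ltn_subLR // ltnW.
  (* At the seam [s l] and [r 0] are both [B], so this is the first step of [r]. *)
  + rewrite il sl -r0 subSnn; apply: re.
    by rewrite -(ltn_add2l l) addn0 -{1}il.
Qed.

Lemma esse_sse (R : realType) (A B : sqmx R) :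
  sqnneg A -> sqnneg B -> esse A B -> sse A B.
Proof.
move=> A0 B0 AB; exists 1%N, (fun i => if i is 0%N then A else B); split=> //.
  by case.
by case.
Qed.

(** The intertwiner maps (1, 1) to 1 + u times itself and y_t to 1 + t times y_u, so it matches
    eigenvectors of equal eigenvalue. *)
Lemma Pmx_intertwine (R : realType) (t u : R) :
  mx2 (1 + t) (u - t) 0 (1 + u) *m Pmx t = Pmx u *m mx2 (1 + t) (u - t) 0 (1 + u).
Proof. by rewrite !Pmx_mx2 !mx2M; congr mx2; field. Qed.

Lemma Pmx_similar (R : realType) (t u : R) :
  0 <= t -> 0 <= u -> similar_in unitmx (Pmx t) (Pmx u).
Proof.
move=> t0 u0; set V := mx2 (1 + t) (u - t) 0 (1 + u).
have Vunit : V \in unitmx.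
  (* [det_trig] expects a lower triangular matrix; [V] is upper triangular. *)
  rewrite -unitmx_tr unitmxE det_trig.
    by rewrite !big_ord_recl big_ord0 !mxE /= mulr1 unitfE; apply: lt0r_neq0; nra.
  apply/is_trig_mxP=> i j; rewrite !mxE.
  by case: i => [[|[|]]] //= i; case: j => [[|[|]]].
by exists V => //; apply/(similarP Vunit)/Pmx_intertwine.
Qed.

(** [W] is the adjugate of [V], so [U] is P_t V^-1. The last hypothesis says exactly that the upper
    right entry of [U] is nonnegative. *)
Lemma Pmx_esse (R : realType) (t u : R) :
  0 <= t -> t <= u < 1 -> (3 + t) * (u - t) <= (1 - t) * (1 + t) ->
  esse (to_sqmx (Pmx t)) (to_sqmx (Pmx u)).
Proof.
move=> t0 /andP[tu u1] small.
set V := mx2 (1 + t) (u - t) 0 (1 + u).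
set W := mx2 (1 + u) (t - u) 0 (1 + t).
have k0 : (1 + t) * (1 + u) != 0 by apply: lt0r_neq0; nra.
pose U := ((1 + t) * (1 + u))^-1 *: (Pmx t *m W).
have WV : W *m V = ((1 + t) * (1 + u))%:M.
  rewrite [RHS]mx2_eta !mxE /= mx2M; congr mx2; ring.
have VW : V *m W = ((1 + t) * (1 + u))%:M.
  rewrite [RHS]mx2_eta !mxE /= mx2M; congr mx2; ring.
exists U, V; split.
- rewrite /U; apply/mxOverP=> i j; rewrite mxE.
  rewrite nnegrE mulr_ge0 ?invr_ge0 //; first nra.
  rewrite -nnegrE; move: i j; apply/mxOverP; rewrite Pmx_mx2 mx2M.
  by apply: mx2_over; rewrite !nnegrE; apply/and4P; split; nra.
- by apply: mx2_over; rewrite !nnegrE; apply/and4P; split; lra.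
- by rewrite /U -scalemxAl -mulmxA WV mul_mx_scalar scalerA mulVf // scale1r.
- rewrite /U -scalemxAr mulmxA Pmx_intertwine -mulmxA VW mul_mx_scalar.
  by rewrite scalerA mulVf // scale1r.
Qed.

Lemma sse_Pmx0 (R : realType) (u : R) :
  0 <= u < 1 -> sse (to_sqmx (Pmx 0)) (to_sqmx (Pmx u)).
Proof.
have P0 : sqnneg (to_sqmx (Pmx (0 : R))) by apply: sqnneg_Pmx; lra.
(* At t = 0 the smallness condition of [Pmx_esse] reads 3 v <= 1. *)
have base (v : R) : 0 <= v < 1 -> v <= 3^-1 ->
    sse (to_sqmx (Pmx 0)) (to_sqmx (Pmx v)).
  move=> /andP[v0 v1] v3; apply: esse_sse => //.
    by apply: sqnneg_Pmx; rewrite v0.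
  by apply: Pmx_esse => //; [rewrite v0 | lra].
move=> /andP[u0 u1].
have [k] : exists k : nat, 1 + u <= 2 ^+ k * (1 - u).
  exists (Num.bound ((1 + u) / (1 - u))).
  by rewrite -ler_pdivrMr ?subr_gt0 // ltW // upper_nthrootP.
elim: k u u0 u1 => [|k IHk] u u0 u1; rewrite ?expr0 ?exprS => uk.
  by apply: base; lra.
case: (leP u 3^-1) => [u3|u3]; first by apply: base; lra.
(* The point t with (1 + t) / (1 - t) = (1 + u) / (2 (1 - u)). *)
pose t := (3 * u - 1) / (3 - u).
have d0 : 0 < 3 - u by lra.
have tE : t * (3 - u) = 3 * u - 1 by rewrite divfK // lt0r_neq0.
have t0 : 0 <= t by nra.
have t1 : t < 1 by nra.
have tu : t <= u by nra.
apply: (@sse_trans _ (to_sqmx (Pmx t))).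
  apply: IHk => //.
  have t1E : 1 - t = 4 * (1 - u) / (3 - u) by rewrite /t; field; rewrite lt0r_neq0.
  have -> : 1 + t = 2 * (1 + u) / (3 - u) by rewrite /t; field; rewrite lt0r_neq0.
  rewrite t1E mulrA ler_pM2r ?invr_gt0 //; lra.
apply: esse_sse; try by apply: sqnneg_Pmx; lra.
(* The smallness condition is an equality here: both sides are 8 (1 - u^2) / (3 - u)^2. *)
apply: Pmx_esse => //; first lra.
nra.
Qed.

(** * Lower bound on the lag *)

Lemma expmx_intertwine (R : pzSemiRingType) (m n : nat) (A : 'M[R]_m)
    (B : 'M[R]_n) (U : 'M[R]_(m, n)) (l : nat) :
  A *m U = U *m B -> A ^+ l *m U = U *m B ^+ l.
Proof.
move=> AU; elim: l => [|l IHl]; first by rewrite !expr0 mul1mx mulmx1.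
by rewrite !exprS -!mulmxE -mulmxA IHl mulmxA AU -mulmxA.
Qed.

Lemma expmx_eigen (R : comPzRingType) (n : nat) (A : 'M[R]_n) (x : 'cV[R]_n)
    (k : R) (l : nat) : A *m x = k *: x -> A ^+ l *m x = k ^+ l *: x.
Proof.
move=> Ax; elim: l => [|l IHl]; first by rewrite !expr0 mul1mx scale1r.
by rewrite !exprS -mulmxE -mulmxA IHl -scalemxAr Ax scalerA mulrC.
Qed.

(** The elementary factors telescope: the first ones are multiplied in order, the second ones in
    reverse order. *)
Lemma is_sse_shift_equiv (R : realType) (l : nat) (s : nat -> sqmx R)
    (A B : sqmx R) :
  is_sse l s A B ->
  exists (U : 'M[R]_(sqdim A, sqdim B)) (V : 'M[R]_(sqdim B, sqdim A)),
    [/\ U \is a mxOver Num.nneg, V \is a mxOver Num.nneg,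
        tagged A *m U = U *m tagged B, V *m tagged A = tagged B *m V
      & U *m V = tagged A ^+ l /\ V *m U = tagged B ^+ l].
Proof.
elim: l B => [|l IHl] B [s0 sl snn se].
  rewrite -sl s0; exists 1%:M, 1%:M.
  by split; rewrite ?mulmx1 ?mul1mx ?mxOver_scalar ?nnegrE ?ler01.
have /IHl[U [V [U0 V0 AU VA [UV VU]]]] : is_sse l s A (s l).
  by split=> // i il; [apply: snn; apply: leqW | apply: se; apply: leqW].
have [U1 [V1 [U10 V10 CE BE]]] := se l (ltnSn l).
rewrite -sl; exists (U *m U1), (V1 *m V); split; try exact: mxOverM.
- by rewrite mulmxA AU BE CE !mulmxA.
- by rewrite -mulmxA VA BE CE !mulmxA.
split; first by rewrite mulmxA -(mulmxA U) -CE -AU -mulmxA UV exprS.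
(* With C = [s l], the factor [V1] moves past C^l because B V1 = V1 U1 V1 = V1 C. *)
rewrite mulmxA -(mulmxA V1) VU exprSr -mulmxE [X in _ = _ *m X]BE mulmxA.
congr (_ *m _); apply/esym/expmx_intertwine.
by rewrite BE CE mulmxA.
Qed.

(** The first row gives (1 - t)(y - x) = 0. *)
Lemma Pmx_fixed (R : realType) (t x y : R) : t < 1 ->
  Pmx t *m col2 x y = col2 x y -> x = y.
Proof. by move=> t1; rewrite Pmx_mx2 mx2_col2 => /col2_inj[]; nra. Qed.

Lemma Pmx_shift_equiv_lag (R : realType) (t : R) (l : nat) (U V : 'M[R]_2) :
  0 <= t < 1 -> U \is a mxOver Num.nneg -> V \is a mxOver Num.nneg ->
  Pmx 0 *m U = U *m Pmx t -> V *m Pmx 0 = Pmx t *m V ->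
  U *m V = Pmx 0 ^+ l -> V *m U = Pmx t ^+ l ->
  2^-1 ^+ l * (1 + t) <= 1 - t.
Proof.
move=> /andP[t0 t1] /mxOverP U0 /mxOverP V0 PU VP UV VU.
have P1 (r : R) : Pmx r *m col2 1 1 = 1 *: col2 1 1.
  by rewrite Pmx_mx2 mx2_col2 scale_col2; congr col2; field.
have Py : Pmx t *m col2 (t - 1) (1 + t) = 2^-1 *: col2 (t - 1) (1 + t).
  by rewrite Pmx_mx2 mx2_col2 scale_col2; congr col2; field.
have := expmx_eigen l (P1 0); rewrite -UV -mulmxA expr1n scale1r => UV1.
have := expmx_eigen l Py; rewrite -VU -mulmxA => VUy.
have V1 : Pmx t *m (V *m col2 1 1) = V *m col2 1 1.
  by rewrite mulmxA -VP -mulmxA P1 scale1r.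
have U1 : Pmx 0 *m (U *m col2 1 1) = U *m col2 1 1.
  by rewrite mulmxA PU -mulmxA P1 scale1r.
have Uy : Pmx 0 *m (U *m col2 (t - 1) (1 + t))
    = 2^-1 *: (U *m col2 (t - 1) (1 + t)).
  by rewrite mulmxA PU -mulmxA Py -scalemxAr.
have := (U0 0 0, U0 0 1, U0 1 0, U0 1 1, (V0 0 0, V0 0 1, V0 1 0, V0 1 1)).
move: UV1 VUy V1 U1 Uy; rewrite (mx2_eta U) (mx2_eta V) !mxE /=.
move: (U 0 0) (U 0 1) (U 1 0) (U 1 1) => a b c d.
move: (V 0 0) (V 0 1) (V 1 0) (V 1 1) => a' b' c' d'.
rewrite !nnegrE !mx2_col2 !scale_col2.
move=> /col2_inj[UV1 _] /col2_inj[_ VUy].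
move=> /(Pmx_fixed t1) V1 /(Pmx_fixed ltr01) U1.
rewrite Pmx_mx2 mx2_col2 => /col2_inj[Uy _] [[[[a0 b0] c0] d0] [[[a'0 b'0] c'0] d'0]].
rewrite -VUy; move: UV1 {VUy}.
(* By a + b = c + d, this sum and the next are 2 b and 2 d. As the coordinates of U y_t are
   opposite, both are at most (1 - t)(a + b) in absolute value. *)
have : a * (t - 1) + b * (1 + t) + (1 - t) * (a + b) >= 0 by nra.
have : c * (t - 1) + d * (1 + t) + (1 - t) * (a + b) >= 0 by nra.
have : c * (t - 1) + d * (1 + t) = - (a * (t - 1) + b * (1 + t)) by lra.
move: (c * (t - 1) + d * (1 + t)) (a * (t - 1) + b * (1 + t)) => z1 z0 z1E z1ge z0ge.
move=> UV1.
(* Each of U and V has equal row sums, and U V fixes (1, 1), so these sums are reciprocal. *)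
have e : (c' + d') * (a + b) = 1 by nra.
have -> : 1 - t = c' * ((1 - t) * (a + b)) + d' * ((1 - t) * (a + b)) by nra.
by apply: lerD; apply: ler_wpM2l => //; lra.
Qed.

Theorem theorem5p1 (R : realType) :
  [/\ forall t : R, 0 <= t < 1 -> Pmx t \is a mxOver Num.pos,
      forall t u : R, 0 <= t < 1 -> 0 <= u < 1 ->
        similar_in unitmx (Pmx t) (Pmx u),
      forall t u : R, 0 <= t < 1 -> 0 <= u < 1 ->
        sse (to_sqmx (Pmx t)) (to_sqmx (Pmx u))
    & forall L : nat, (2 <= L)%N ->
        exists2 t : R, 0 < t < 1 &
          ~ exists (l : nat) (s : nat -> sqmx R),
              [/\ is_sse l s (to_sqmx (Pmx 0)) (to_sqmx (Pmx t)),
                  (l < L)%N & (sse_size l s < L)%N]].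
Proof.
split.
- exact: Pmx_pos.
- by move=> t u /andP[t0 _] /andP[u0 _]; apply: Pmx_similar.
- move=> t u t01 u01; apply: sse_trans (sse_Pmx0 u01).
  exact/sse_sym/sse_Pmx0.
- move=> L L2; pose e : R := 2^-1 ^+ L.
  have e0 : 0 < e by rewrite exprn_gt0 // invr_gt0.
  have e1 : e < 1.
    by rewrite exprn_ilt1 ?invr_ge0 ?invf_lt1 ?ltr1n // -lt0n ltnW.
  (* For l < L one has 2^-l >= e, so the lag bound would give e (2 - e) <= e, against 0 < e < 1. *)
  exists (1 - e); first lra.
  move=> [l [s [/is_sse_shift_equiv /= [U [V [U0 V0 PU VP [UV VU]]]] lL _]]].
  have := Pmx_shift_equiv_lag _ U0 V0 PU VP UV VU.
  have le : e <= 2^-1 ^+ l.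
    by rewrite ler_wiXn2l ?invr_ge0 ?invf_le1 ?ler1n // ltnW.
  move=> /(_ ltac:(lra)); nra.
Qed.
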